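(* Let $n\in\mathbb{N}$ be odd. Start with a deck of $n$ cards, all face down, i.e. the array $(1,2,\ldots,n)$, and apply any finite sequence of DATO shuffles, i.e. of maps $\delta_k$ and $\gamma_j$ with $k,j\le n$ even (the values of $k$ and $j$ may vary from step to step). Then in the resulting array every face-up card that is in an even position was originally in an odd position, and every face-up card that is in an odd position was originally in an even position. In other words, if the resulting array is $(a_1,\ldots,a_n)$ and $a_p=\overline{i}$ for some $p,i\in\{1,\ldots,n\}$, then $p$ and $i$ have opposite parity.
   Context: A deck of $n$ cards is represented by an array $(a_1,\ldots,a_n)$ (listed from top to bottom, $a_p$ being the card in position $p$) with entries in $\{1,\ldots,n,\overline{1},\ldots,\overline{n}\}$, in which each card $i\in\{1,\ldots,n\}$ occurs exactly once, either as $i$ (face down) or as $\overline{i}$ (face up). The number $i$ records the initial position of the card; the bar denotes a change of orientation, and $\overline{\overline{i}}=i$. DATO (Deal And Turn Over) shuffles consist of applying the following two kinds of operations, in any order and as many times as desired: (1) Turning over an even number $k\le n$ of cards from the top as if they were a single card: $$\delta_k:(a_1,\ldots,a_k,a_{k+1},\ldots,a_n)\mapsto(\overline{a_k},\overline{a_{k-1}},\ldots,\overline{a_1},a_{k+1},\ldots,a_n).$$ (2) Dealing an even number $j\le n$ of cards from the top one by one (which reverses their order without changing their orientation) and completing the cut: $$\gamma_j:(a_1,\ldots,a_j,a_{j+1},\ldots,a_n)\mapsto(a_{j+1},\ldots,a_n,a_j,a_{j-1},\ldots,a_1).$$ *)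

(* Defs.v *)
(* Decks are listed from top to bottom. *)
From mathcomp Require Import all_boot.
Set Implicit Arguments.
Unset Strict Implicit.
Unset Printing Implicit Defensive.

(* [(i, false)] is the card i face down; [(i, true)] is i-bar, i face up. *)
Definition card := (nat * bool)%type.

Definition card_bar (c : card) : card := (c.1, ~~ c.2).

Definition deck := seq card.

Definition is_deck (n : nat) (a : deck) : bool := perm_eq (unzip1 a) (iota 1 n).

Definition start_deck (n : nat) : deck := [seq (i, false) | i <- iota 1 n].

(* Positions are counted from 1; only meaningful for 1 <= p <= size a. *)
Definition card_at (a : deck) (p : nat) : card := nth (0, false) a p.-1.

Definition delta (k : nat) (a : deck) : deck :=
  [seq card_bar c | c <- rev (take k a)] ++ drop k a.

Definition gamma (j : nat) (a : deck) : deck :=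
  drop j a ++ rev (take j a).

Inductive dato_move := TurnOver of nat | Deal of nat.

Definition move_count (m : dato_move) : nat :=
  match m with TurnOver k => k | Deal j => j end.

Definition dato_legal (n : nat) (m : dato_move) : bool :=
  ~~ odd (move_count m) && (move_count m <= n).

Definition dato_step (a : deck) (m : dato_move) : deck :=
  match m with TurnOver k => delta k a | Deal j => gamma j a end.

Definition dato_shuffle (a : deck) (ms : seq dato_move) : deck :=
  foldl dato_step a ms.

Lemma start_deckP n : is_deck n (start_deck n).
Proof. by rewrite /is_deck /unzip1 -map_comp map_id. Qed.

Lemma dato_stepP n a m : is_deck n a -> is_deck n (dato_step a m).
Proof.
rewrite /is_deck; apply: perm_trans.
case: m => k /=; rewrite -[in X in perm_eq _ X](cat_take_drop k a).
  by rewrite /unzip1 !map_cat -map_comp perm_cat2r map_rev perm_rev.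
by apply: perm_map; rewrite perm_catC perm_cat2r perm_rev.
Qed.

Lemma dato_shuffleP n a ms : is_deck n a -> is_deck n (dato_shuffle a ms).
Proof. by elim: ms a => //= m ms IH a /(dato_stepP m)/IH. Qed.

(* Main.v *)
Require Import Defs.
From mathcomp Require Import all_boot.

(** Face-up cards cannot be controlled without the face-down ones, so the
    property carried through the shuffle concerns every card: the parity of its
    position, the parity of its number and its orientation add up to zero mod 2.
    Face-down cards thus sit at a position of the parity of their number, and
    face-up cards at one of the opposite parity. This holds for the initial
    deck. Turning over [k] cards sends position [p <= k] to [k + 1 - p], which
    has the other parity because [k] is even, and at the same time changes the
    orientation. Dealing [j] cards sends [p <= j] to [n + 1 - p] and [p > j] to
    [p - j]; both keep the parity because [n] is odd and [j] is even, and no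
    orientation changes. *)

(** Positions are indexed from 0 here, hence the successor. *)
Definition parity_balanced (a : deck) : Prop :=
  forall q, q < size a ->
    odd q.+1 = odd (nth (0, false) a q).1 (+) (nth (0, false) a q).2.

Lemma parity_balanced_start n : parity_balanced (start_deck n).
Proof.
move=> q; rewrite /start_deck size_map size_iota => ltqn.
by rewrite (nth_map 0) ?size_iota // nth_iota //= addbF.
Qed.

Lemma size_dato_step a m : size (dato_step a m) = size a.
Proof.
case: m => k /=.
  by rewrite size_cat size_map size_rev -size_cat cat_take_drop.
by rewrite size_cat size_rev addnC -size_cat cat_take_drop.
Qed.

(** The two changes compensate: the reversal of an even block flips the parity
    of a position, and the turn flips the orientation. *)
Lemma parity_balanced_delta k a :
  ~~ odd k -> k <= size a -> parity_balanced a -> parity_balanced (delta k a).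
Proof.
move=> even_k le_ka bal q.
rewrite (size_dato_step a (TurnOver k)) => lt_qa.
rewrite /delta nth_cat size_map size_rev size_takel //.
case: ltnP => [lt_qk | le_kq]; last by rewrite nth_drop subnKC //; exact: bal.
rewrite (nth_map (0, false)) ?size_rev ?size_takel //.
rewrite nth_rev ?size_takel // nth_take ?ltn_subrL ?(leq_ltn_trans _ lt_qk) //=.
rewrite addbN -bal; last first.
  by apply: leq_trans le_ka; rewrite ltn_subrL (leq_ltn_trans _ lt_qk).
by rewrite -subSn // subSS oddB 1?ltnW // (negbTE even_k).
Qed.

(** The dealt block is reversed about the whole deck, whose size is odd, so its
    cards keep the parity of their positions; the others move by an even
    distance. *)
Lemma parity_balanced_gamma j a :
  odd (size a) -> ~~ odd j -> j <= size a ->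
  parity_balanced a -> parity_balanced (gamma j a).
Proof.
move=> odd_a even_j le_ja bal q.
rewrite (size_dato_step a (Deal j)) => lt_qa.
rewrite /gamma nth_cat size_drop.
case: ltnP => [lt_q | le_q].
  rewrite nth_drop -bal; last by rewrite -ltn_subRL.
  by rewrite /= oddD (negbTE even_j).
have lt_qj : q - (size a - j) < j by rewrite ltn_subLR // subnK.
rewrite nth_rev ?size_takel // nth_take; last first.
  by rewrite ltn_subrL (leq_ltn_trans _ lt_qj).
(* The card now at index [q] was at index [size a - q.+1]. *)
have -> : j - (q - (size a - j)).+1 = size a - q.+1.
  by rewrite -subSn // subnBA ?leqW // subnKC.
rewrite -bal; last by rewrite ltn_subrL (leq_ltn_trans _ lt_qa).
by rewrite -subSn // subSS oddB 1?ltnW // odd_a.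
Qed.

Lemma parity_balanced_step n a m :
  odd n -> size a = n -> dato_legal n m ->
  parity_balanced a -> parity_balanced (dato_step a m).
Proof.
move=> odd_n size_a; case: m => k /andP[/= even_k le_kn].
  by apply: parity_balanced_delta; rewrite ?size_a.
by apply: parity_balanced_gamma; rewrite ?size_a.
Qed.

Lemma parity_balanced_shuffle n a ms :
  odd n -> size a = n -> all (dato_legal n) ms ->
  parity_balanced a -> parity_balanced (dato_shuffle a ms).
Proof.
move=> odd_n; elim: ms a => //= m ms IH a size_a /andP[legal_m legal_ms] bal.
by apply: IH => //; [rewrite size_dato_step | exact: (@parity_balanced_step n)].
Qed.

Lemma size_dato_shuffle a ms : size (dato_shuffle a ms) = size a.
Proof. by elim: ms a => //= m ms IH a; rewrite IH size_dato_step. Qed.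

Theorem theorem5p2 (n : nat) (hn : odd n) (ms : seq dato_move)
    (hms : all (dato_legal n) ms) (p i : nat)
    (hp : 1 <= p <= n) (hi : 1 <= i <= n)
    (hpi : card_at (dato_shuffle (start_deck n) ms) p = (i, true)) :
  odd p = ~~ odd i.
Proof.
have size_start : size (start_deck n) = n by rewrite size_map size_iota.
have [lt0p le_pn] := andP hp.
have bal := @parity_balanced_shuffle n _ ms hn size_start hms
              (@parity_balanced_start n).
move: (bal p.-1); rewrite size_dato_shuffle size_start prednK //.
by move: hpi; rewrite /card_at => -> /(_ le_pn) ->; rewrite /= addbT.
Qed.
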